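(* Let $p$ be a prime. Translation-invariant $p$-adic Gibbs measures for the $q$-state $p$-adic Potts model on the Cayley tree of order two are bounded if and only if $q\notin p\mathbb N$. (That is: every TIpGM $\mu$ of the model is bounded when $p\nmid q$, and every TIpGM of the model is unbounded when $p\mid q$.)
   Context: $\mathbb Q_p$ is the field of $p$-adic numbers with norm $|\cdot|_p$; $\exp_p(x)=\sum_{n\ge 0} x^n/n!$ for $|x|_p<p^{-1/(p-1)}$. The Cayley tree $\Gamma^k=(V,L)$ of order $k$ is the infinite tree in which every vertex has exactly $k+1$ edges; here $k=2$. Fix a root $x^0$; $W_n$ is the set of vertices at distance $n$ from $x^0$, $V_n=\bigcup_{m=0}^nW_m$. Spins take values in $\Phi=\{1,\dots,q\}$, $q\ge2$. Let $J\in\mathbb Q_p$ with $|J|_p<p^{-1/(p-1)}$, $\theta=\exp_p(J)$, and $H_n(\sigma_n)=J\sum_{\langle x,y\rangle:\,x,y\in V_n}\delta_{\sigma_n(x)\sigma_n(y)}$ for $\sigma_n\in\Phi^{V_n}$ (sum over edges). For a collection $\tilde h=\{\tilde h_x=(\tilde h_{1,x},\dots,\tilde h_{q,x})\in\mathbb Q_p^q,\ x\in V\}$ (with all exponentials defined and $Z_{n,\tilde h}\neq0$) put $$\mu^{(n)}_{\tilde h}(\sigma_n)=Z_{n,\tilde h}^{-1}\exp_p\Big\{H_n(\sigma_n)+\sum_{x\in W_n}\tilde h_{\sigma_n(x),x}\Big\},\qquad n\ge1,$$ where $Z_{n,\tilde h}$ is the normalizing factor. If these are compatible, i.e. $\sum_{\omega\in\Phi^{W_n}}\mu^{(n)}_{\tilde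 h}(\sigma_{n-1}\vee\omega)=\mu^{(n-1)}_{\tilde h}(\sigma_{n-1})$ for all $n\ge2$ and $\sigma_{n-1}\in\Phi^{V_{n-1}}$, the unique finitely additive $\mathbb Q_p$-valued measure $\mu_{\tilde h}$ on the algebra $\mathcal B$ of cylinder sets of $\Phi^V$ with $\mu_{\tilde h}(\{\sigma|_{V_n}=\sigma_n\})=\mu^{(n)}_{\tilde h}(\sigma_n)$ is called a $p$-adic Gibbs measure. It is translation-invariant (a TIpGM) if the vector $h_x=(\tilde h_{i,x}-\tilde h_{q,x})_{i=1}^{q-1}$ does not depend on $x\in V$. A $p$-adic probability measure $\mu$ is bounded if $\sup\{|\mu(A)|_p:A\in\mathcal B\}<\infty$. *)

(* Defs.v *)
From HB Require Import structures.
From mathcomp Require Import all_boot all_order all_algebra finmap.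
From mathcomp Require Import all_classical all_reals all_analysis.
Set Implicit Arguments.
Unset Strict Implicit.
Unset Printing Implicit Defensive.
Import Order.TTheory GRing.Theory Num.Theory.
Import numFieldNormedType.Exports.
Local Open Scope classical_set_scope.
Local Open Scope ring_scope.

Section PadicNumbers.
Context {R : realType} (p : nat).

Definition rat_padic_abs (r : rat) : R :=
  if r == 0 then 0
  else p%:R ^ (Posz (logn p `|denq r|) - Posz (logn p `|numq r|)).

(* [is_Qp p abs]: the field [K] with the absolute value [abs] is the completion
   of the rationals for the [p]-adic absolute value; this determines
   [(K, abs)] up to a unique isometric isomorphism. *)
Record is_Qp (K : fieldType) (abs : K -> R) : Prop := IsQp {
  Qp_abs0_eq0 : forall x, abs x = 0 -> x = 0 ;
  Qp_absM : {morph abs : x y / x * y} ;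
  Qp_abs_ultra : forall x y, abs (x + y) <= Num.max (abs x) (abs y) ;
  Qp_abs_ratr : forall r : rat, abs (ratr r) = rat_padic_abs r ;
  Qp_dense : forall (x : K) (eps : R), 0 < eps ->
    exists r : rat, abs (x - ratr r) < eps ;
  Qp_complete : forall u : nat -> K,
    (forall eps : R, 0 < eps -> exists N, forall m n,
       (N <= m)%N -> (N <= n)%N -> abs (u m - u n) < eps) ->
    exists l : K, (fun n => abs (u n - l)) @ \oo --> (0 : R)
}.

Definition padic_exp_radius : R := p%:R `^ (- (p.-1%:R)^-1).

(* Junk value [0] when the series diverges. *)
Definition padic_exp (K : fieldType) (abs : K -> R) (x : K) : K :=
  xget 0 [set l | (fun N =>
    abs (\sum_(0 <= n < N) x ^+ n / (n`!)%:R - l)) @ \oo --> (0 : R)].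

End PadicNumbers.

Section CayleyTree.
Context (V : choiceType) (e : rel V).

(* [e] is the adjacency relation of a simple graph. *)
Record is_cayley_tree (k : nat) : Prop := IsCayleyTree {
  tree_sym : symmetric e ;
  tree_irrefl : irreflexive e ;
  tree_connected : forall x y, exists s : seq V, path e x s /\ last x s = y ;
  tree_acyclic : forall c : seq V, (2 < size c)%N -> ~ ucycle e c ;
  tree_infinite : infinite_set [set: V] ;
  tree_regular : forall x, exists A : {fset V},
    (forall y, (y \in A) = e x y) /\ #|` A| = k.+1
}.

Definition at_distance (x y : V) (n : nat) : Prop :=
  (exists s : seq V, [/\ path e x s, last x s = y & size s = n]) /\
  (forall s : seq V, path e x s -> last x s = y -> (n <= size s)%N).

(* [fset_set] returns the empty set on infinite sets; [finite_sphere] below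
   shows that this case does not occur. *)
Definition sphere (x0 : V) (n : nat) : {fset V} :=
  fset_set [set x | at_distance x0 x n].

(* The union of the spheres of radius [0], ..., [n]; the recursive form makes
   the ball of radius [n.+1] convertible to a union, as [glue] requires. *)
Fixpoint ball_at (x0 : V) (n : nat) : {fset V} :=
  if n is m.+1 then (ball_at x0 m `|` sphere x0 m.+1)%fset else sphere x0 0.

Lemma finite_sphere k (x0 : V) n :
  is_cayley_tree k -> finite_set [set x | at_distance x0 x n].
Proof.
move=> He.
suff: finite_set [set x | exists s : seq V,
    [/\ path e x0 s, last x0 s = x & size s = n]].
  by apply: sub_finite_set => x [].
elim: n => [|n IH].
  apply: (@sub_finite_set _ _ [set x0]); last exact: finite_set1.
  by move=> x [s [_ <- /size0nil ->]].
pose N x := [set y | e x y].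
apply: (@sub_finite_set _ _ (\bigcup_(x in [set x | exists s : seq V,
    [/\ path e x0 s, last x0 s = x & size s = n]]) N x)).
  move=> y [s]; case/lastP: s => [|s z] [] // + + /eqP.
  rewrite rcons_path last_rcons size_rcons eqSS => /andP[ps ez] <- /eqP ss.
  by exists (last x0 s) => //; exists s.
apply: bigcup_finite => // x _.
have [A [HA _]] := tree_regular He x.
apply: (@sub_finite_set _ _ [set` A]); last exact: finite_fset.
by move=> y; rewrite /N /= HA.
Qed.

End CayleyTree.

Section Configurations.
Context {V : choiceType} {T : finType}.

Lemma in_fsetU_notl (A B : {fset V}) (x : (A `|` B)%fset) :
  val x \notin A -> val x \in B.
Proof. by case: x => x /=; rewrite in_fsetU => /orP[->|]. Qed.

Definition glue (A B : {fset V}) (s : {ffun A -> T}) (w : {ffun B -> T}) :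
    {ffun (A `|` B)%fset -> T} :=
  [ffun x => match boolP (val x \in A) with
             | AltTrue xA => s [` xA]%fset
             | AltFalse xNA => w [` in_fsetU_notl xNA]%fset
             end].

Definition restr (A : {fset V}) (sigma : V -> T) : {ffun A -> T} :=
  [ffun x => sigma (val x)].

Definition cylinder (X : set (V -> T)) : Prop :=
  exists (A : {fset V}) (C : {set {ffun A -> T}}),
    X = [set sigma | restr A sigma \in C].

End Configurations.

Section PottsModel.
Context {R : realType} (p q : nat) (K : fieldType) (abs : K -> R).
Context (V : choiceType) (e : rel V) (x0 : V) (J : K).

(* The spins 1, ..., q are represented by 0, ..., q - 1 in ['I_q]. *)
Local Notation conf A := {ffun A -> 'I_q}.
Local Notation W := (sphere e x0).
Local Notation Vn := (ball_at e x0).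

Definition is_edge (A : {fset V}) (b : {set A}) : bool :=
  [exists x : A, exists y : A, e (val x) (val y) && (b == [set x; y]%SET)].

(* Each unordered edge is counted once; a factor [true%:R] occurs when the two
   endpoints carry the same spin. *)
Definition hamiltonian n (s : conf (Vn n)) : K :=
  J * \sum_(b : {set Vn n} | is_edge b)
        [forall x in b, forall y in b, s x == s y]%:R.

Definition exponent (h : V -> 'I_q -> K) n (s : conf (Vn n)) : K :=
  hamiltonian s + \sum_(x : Vn n | val x \in W n) h (val x) (s x).

Definition partition_function (h : V -> 'I_q -> K) n : K :=
  \sum_(s : conf (Vn n)) padic_exp abs (exponent h s).

Definition gibbs_weight (h : V -> 'I_q -> K) n (s : conf (Vn n)) : K :=
  (partition_function h n)^-1 * padic_exp abs (exponent h s).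

Definition admissible (h : V -> 'I_q -> K) : Prop :=
  forall n, (1 <= n)%N ->
    (forall s : conf (Vn n), abs (exponent h s) < padic_exp_radius p) /\
    partition_function h n != 0.

Definition compatible (h : V -> 'I_q -> K) : Prop :=
  forall n, (1 <= n)%N -> forall s : conf (Vn n),
    \sum_(w : conf (W n.+1)) @gibbs_weight h n.+1 (glue s w)
      = gibbs_weight h s.

(* Values of [mu] outside the algebra of cylinder sets are irrelevant. *)
Definition finitely_additive (mu : set (V -> 'I_q) -> K) : Prop :=
  forall X Y, cylinder X -> cylinder Y -> X `&` Y = set0 ->
    mu (X `|` Y) = mu X + mu Y.

Definition gibbs_measure_of (h : V -> 'I_q -> K)
    (mu : set (V -> 'I_q) -> K) : Prop :=
  [/\ admissible h, compatible h, finitely_additive mu &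
      forall n, (1 <= n)%N -> forall s : conf (Vn n),
        mu [set sigma | restr (Vn n) sigma = s] = gibbs_weight h s].

Definition translation_invariant (h : V -> 'I_q -> K) : Prop :=
  forall l : 'I_q, l = q.-1 :> nat ->
    forall (i : 'I_q) (x y : V), h x i - h x l = h y i - h y l.

Definition is_TIpGM (mu : set (V -> 'I_q) -> K) : Prop :=
  exists h, gibbs_measure_of h mu /\ translation_invariant h.

Definition bounded_measure (mu : set (V -> 'I_q) -> K) : Prop :=
  has_ubound [set abs (mu X) | X in [set X | cylinder X]].

End PottsModel.

(* Main.v *)
(* An exponential [exp_p(y)] with |y| < r = p^(-1/(p-1)) satisfies
   |exp_p(y) - 1| < r < 1, so every Boltzmann factor has absolute value 1 and a
   cylinder fixing the configuration on the ball of radius n has measure of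
   absolute value 1/|Z_n|.  As Z_n is a sum of q^|V_n| such factors, |Z_n| = 1
   when p does not divide q, and every cylinder set has measure of absolute
   value at most 1.  When p divides q, compatibility expresses Z_{n+1} / Z_n as
   a sum of q^|W_{n+1}| factors times one inverse factor; hence
   |Z_{n+1}| <= r |Z_n|, and 1/|Z_n| tends to infinity. *)
Require Import Defs.
From mathcomp Require Import all_boot all_order all_algebra finmap.
From mathcomp Require Import all_classical all_reals all_analysis.
Import Order.TTheory GRing.Theory Num.Theory.
Import numFieldNormedType.Exports.
Local Open Scope ring_scope.
Set Implicit Arguments.
Unset Strict Implicit.
Unset Printing Implicit Defensive.

(** * The [p]-adic valuation of factorials *)

Lemma ltn_logn_fact (p n : nat) : prime p -> (0 < n)%N ->
  (p.-1 * logn p n`! < n)%N.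
Proof.
move=> pp n0; have p0 := prime_gt0 pp.
(* A truncated geometric series bounds Legendre's sum: [p - 1] times its first [m] terms is at most
   [n * (1 - p ^- m)], here multiplied by [p ^ m] to stay in [nat]. Truncation at [m = n] gives
   strictness. *)
suff H m : (p ^ m * (p.-1 * \sum_(1 <= k < m.+1) n %/ p ^ k)
            <= n * (p ^ m).-1)%N.
  rewrite logn_fact // -(@ltn_pmul2l (p ^ n)) ?expn_gt0 ?p0 //.
  apply: leq_ltn_trans (H n) _.
  by rewrite mulnC ltn_pmul2r // prednK // expn_gt0 p0.
elim: m => [|m IH]; first by rewrite big_geq // !muln0.
rewrite big_nat_recr //= mulnDr mulnDr.
have -> : (n * (p ^ m.+1).-1 = p * (n * (p ^ m).-1) + p.-1 * n)%N.
  apply: (@addIn n).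
  rewrite -addnA -mulnSr -[in RHS]mulSnr !prednK ?expn_gt0 ?p0 //.
  by rewrite -mulnDr -mulnSr prednK ?expn_gt0 ?p0 // expnS mulnCA.
apply: leq_add.
  by rewrite expnS -mulnA leq_mul2l IH orbT.
by rewrite mulnCA leq_mul2l mulnC leq_divM orbT.
Qed.

(** * The [p]-adic absolute value and exponential *)

Section Padic.
Context {R : realType} {p : nat} {K : fieldType} {abs : K -> R}.
Hypotheses (p_prime : prime p) (K_Qp : is_Qp p abs).
Local Open Scope classical_set_scope.

Lemma abs_natr n : (0 < n)%N -> abs n%:R = p%:R ^- logn p n.
Proof.
move=> n0; rewrite -[n%:R](ratr_nat K) (Qp_abs_ratr K_Qp) /rat_padic_abs.
rewrite pnatr_eq0 (gtn_eqF n0).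
by rewrite -[n%:R]/(n%:~R) numq_int denq_int /= logn1 sub0r -exprnN.
Qed.

Lemma abs0 : abs 0 = 0.
Proof. by have := Qp_abs_ratr K_Qp 0%:R; rewrite ratr_nat. Qed.

Lemma abs1 : abs 1 = 1.
Proof. by rewrite (abs_natr (n := 1)) // logn1 expr0 invr1. Qed.

Lemma absN x : abs (- x) = abs x.
Proof.
rewrite -mulN1r (Qp_absM K_Qp).
have := Qp_abs_ratr K_Qp (-1)%:~R.
rewrite ratr_int => ->; rewrite /rat_padic_abs.
by rewrite numq_int denq_int /= logn1 subrr expr0z mul1r.
Qed.

(** [is_Qp] does not list nonnegativity; it follows from the ultrametric inequality for [x] and
    [- x]. *)
Lemma abs_ge0 x : 0 <= abs x.
Proof.
have := Qp_abs_ultra K_Qp x (- x).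
by rewrite subrr abs0 absN maxxx.
Qed.

Lemma absX x n : abs (x ^+ n) = abs x ^+ n.
Proof.
by elim: n => [|n IH]; rewrite ?expr0 ?abs1 // !exprS (Qp_absM K_Qp) IH.
Qed.

Lemma abs_gt0 x : x != 0 -> 0 < abs x.
Proof.
move=> x0; rewrite lt_neqAle abs_ge0 andbT eq_sym.
by apply: contra_neq x0 => /(Qp_abs0_eq0 K_Qp).
Qed.

Lemma absV x : x != 0 -> abs x^-1 = (abs x)^-1.
Proof.
move=> x0; apply: (mulfI (lt0r_neq0 (abs_gt0 x0))).
by rewrite -(Qp_absM K_Qp) !divff ?abs1 // lt0r_neq0 // abs_gt0.
Qed.

Lemma abs_add_le x y c : abs x <= c -> abs y <= c -> abs (x + y) <= c.
Proof.
by move=> xc yc; apply: le_trans (Qp_abs_ultra K_Qp x y) _; rewrite ge_max xc.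
Qed.

Lemma abs_add_lt x y c : abs x < c -> abs y < c -> abs (x + y) < c.
Proof.
by move=> xc yc; apply: le_lt_trans (Qp_abs_ultra K_Qp x y) _; rewrite gt_max xc.
Qed.

Lemma abs_sum_le I (s : seq I) (P : pred I) F c : 0 <= c ->
  (forall i, P i -> abs (F i) <= c) -> abs (\sum_(i <- s | P i) F i) <= c.
Proof.
move=> c0 H; elim/big_rec: _ => [|i x Pi xc]; first by rewrite abs0.
by apply: abs_add_le => //; apply: H.
Qed.

(** If [abs x] were below [abs y], then [y = x - (x - y)] would be a difference of two elements
    smaller than [y]. *)
Lemma abs_near_eq x y : abs (x - y) < abs y -> abs x = abs y.
Proof.
move=> xy; apply/eqP; rewrite eq_le; apply/andP; split.
  by rewrite -[x](subrK y) abs_add_le // ltW.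
rewrite leNgt; apply/negP => lxy.
suff : abs y < abs y by rewrite ltxx.
rewrite -{1}[y](subKr x); apply: abs_add_lt => //.
by rewrite absN.
Qed.

Local Notation r := (@padic_exp_radius R p).

Lemma p_gt1 : 1 < p%:R :> R.
Proof. by rewrite ltr1n prime_gt1. Qed.

Lemma p_gt0 : 0 < p%:R :> R.
Proof. exact: lt_trans p_gt1. Qed.

Lemma pred_p_gt0 : (0 < p.-1)%N.
Proof. by rewrite -ltnS prednK ?prime_gt1 ?prime_gt0. Qed.

Lemma padic_exp_radius_gt0 : 0 < r.
Proof. exact: powR_gt0 p_gt0. Qed.

(** Equality holds at [p = 2], hence the weak inequality in [abs_sum_units_le]. *)
Lemma inv_p_le_padic_exp_radius : p%:R^-1 <= r.
Proof.
rewrite -powR_inv1 ?(ltW p_gt0) // ler_powR ?(ltW p_gt1) //.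
by rewrite lerN2 invf_le1 ?ltr0n ?pred_p_gt0 ?pred_p_gt0 // ler1n pred_p_gt0.
Qed.

Lemma padic_exp_radius_lt1 : r < 1.
Proof.
rewrite /padic_exp_radius powRN invf_lt1 ?powR_gt0 ?p_gt0 //.
have inv_pred_gt0 : 0 < p.-1%:R^-1 :> R by rewrite invr_gt0 ltr0n pred_p_gt0.
have := gt0_ltr_powR inv_pred_gt0 _ _ p_gt1.
by rewrite powR1; apply; rewrite nnegrE ?ler01 // (ltW p_gt0).
Qed.

(** Since [(p - 1) * logn p (m.+1)! <= m], dividing by the factorial costs at most [r ^- m]. The
    factor [abs x] left over keeps every nonconstant term below [r], while the power gives geometric
    decay. *)
Lemma abs_exp_term_le x m :
  abs (x ^+ m.+1 / (m.+1`!)%:R) <= abs x * (abs x / r) ^+ m.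
Proof.
have f0 : (m.+1`!)%:R != 0 :> K.
  apply/eqP => f0; have := abs_natr (fact_gt0 m.+1).
  by rewrite f0 abs0 => /esym/eqP; rewrite invr_eq0 expf_eq0 (gt_eqF p_gt0) andbF.
rewrite (Qp_absM K_Qp) absX absV // abs_natr ?fact_gt0 // invrK exprS -mulrA.
rewrite ler_wpM2l ?abs_ge0 // expr_div_n ler_wpM2l ?exprn_ge0 ?abs_ge0 //.
rewrite /padic_exp_radius powRN -exprVn invrK.
rewrite -!powR_mulrn ?powR_ge0 ?(ltW p_gt0) //.
rewrite -powRrM ler_powR ?(ltW p_gt1) //.
rewrite mulrC ler_pdivlMr ?ltr0n ?pred_p_gt0 // -natrM ler_nat mulnC -ltnS.
exact: ltn_logn_fact.
Qed.

(* Since [padic_exp] takes the junk value [0] off its domain of convergence,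
   convergence of the exponential series has to be established. *)
Lemma abs_padic_exp_sub1_lt x : abs x < r -> abs (padic_exp abs x - 1) < r.
Proof.
move=> xr; set S := fun N => \sum_(0 <= n < N) x ^+ n / (n`!)%:R.
set rho := abs x / r.
have r0 := padic_exp_radius_gt0.
have rho0 : 0 <= rho by rewrite divr_ge0 ?abs_ge0 // ltW.
have rho1 : rho < 1 by rewrite ltr_pdivrMr ?mul1r.
(* Strictness of [N < m] excludes the constant term and absorbs the index shift in
   [abs_exp_term_le]. *)
have tail N m n : (N < m)%N -> (m <= n)%N -> abs (S n - S m) <= abs x * rho ^+ N.
  move=> Nm mn; rewrite /S (big_cat_nat (leq0n m) mn) /= addrAC subrr add0r.
  rewrite big_nat; apply: abs_sum_le => [|[|i] /andP[mi _]].
  - by rewrite mulr_ge0 ?exprn_ge0 ?abs_ge0.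
  - by case: m Nm mi {mn}.
  apply: le_trans (abs_exp_term_le x i) _.
  rewrite ler_wpM2l ?abs_ge0 // ler_wiXn2l // ?ltW //.
  by rewrite -ltnS (leq_trans Nm).
have [l Sl] : exists l, (fun n => abs (S n - l)) @ \oo --> (0 : R).
  apply: (Qp_complete K_Qp) => eps eps0.
  have : (fun N => abs x * rho ^+ N) @ \oo --> (0 : R).
    rewrite -(mulr0 (abs x)); apply: cvgMr; apply: cvg_expr.
    by rewrite ger0_norm.
  move=> /cvgrPdist_lt /(_ eps eps0) [N _ /(_ N (leqnn N))] /=.
  rewrite sub0r normrN ger0_norm ?mulr_ge0 ?exprn_ge0 ?abs_ge0 // => HN.
  exists N.+1 => m n Nm Nn.
  case: (leqP m n) => mn.
    rewrite -absN opprB; exact: le_lt_trans (tail _ _ _ Nm mn) HN.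
  exact: le_lt_trans (tail _ _ _ Nn (ltnW mn)) HN.
(* The existence of [l] rules out the default value; the estimate is made for whichever limit [l']
   is chosen. *)
rewrite /padic_exp; case: xgetP => [l' _ /= Sl'|/(_ l)/(_ Sl)//].
move: Sl' => /cvgrPdist_lt /(_ r r0) [N _ /(_ N.+1 (leqnSn N))] /=.
rewrite sub0r normrN ger0_norm ?abs_ge0 // -/(S N.+1) => HN.
(* Split [l' - 1] at [S N.+1], which is within [r] of [l'] by the choice of [N] and within [abs x]
   of [S 1 = 1]. *)
rewrite -[l'](subrK (S N.+1)) -addrA; apply: abs_add_lt.
  by rewrite -absN opprB.
have := tail 0%N 1%N N.+1 isT isT.
rewrite {2}/S big_nat1 fact0 divr1 expr0 mulr1 => H.
exact: le_lt_trans H xr.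
Qed.

Lemma abs_sub1_eq1 x : abs (x - 1) < r -> abs x = 1.
Proof.
move=> H; rewrite -abs1; apply: abs_near_eq; rewrite abs1.
exact: lt_trans H padic_exp_radius_lt1.
Qed.

(** * Finite sums of elements close to 1 *)

Section SumOfUnits.
Context {I : finType} {F : I -> K}.
Hypothesis F1 : forall i, abs (F i - 1) < r.

Lemma abs_sum_sub_card_lt : abs (\sum_i F i - #|I|%:R) < r.
Proof.
rewrite -sum1_card natr_sum -sumrB.
elim/big_rec: _ => [|i x _ xr]; first by rewrite abs0 padic_exp_radius_gt0.
exact: abs_add_lt.
Qed.

Lemma abs_sum_units_eq1 : coprime p #|I| -> abs (\sum_i F i) = 1.
Proof.
move=> pI; have I0 : (0 < #|I|)%N.
  rewrite lt0n; apply: contraTneq pI => ->.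
  by rewrite /coprime gcdn0 gtn_eqF ?prime_gt1.
have aI : abs #|I|%:R = 1 by rewrite abs_natr // logn_coprime // expr0 invr1.
rewrite -aI; apply: abs_near_eq; rewrite aI.
exact: lt_trans abs_sum_sub_card_lt padic_exp_radius_lt1.
Qed.

(** The sum is within [r] of [#|I|], whose own absolute value is at most [1/p <= r]. *)
Lemma abs_sum_units_le : (p %| #|I|)%N -> abs (\sum_i F i) <= r.
Proof.
move=> pI; rewrite -[\sum_i F i](subrK #|I|%:R).
apply: abs_add_le; first exact: ltW abs_sum_sub_card_lt.
move: pI => /dvdnP[k ->].
case: (posnP k) => [->|k0]; first by rewrite mul0n abs0 ltW ?padic_exp_radius_gt0.
apply: le_trans inv_p_le_padic_exp_radius.
rewrite abs_natr ?muln_gt0 ?k0 ?prime_gt0 //.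
rewrite lognM ?(prime_gt0 p_prime) // (logn_prime p p_prime) eqxx exprD expr1 invfM.
rewrite ler_piMl ?invr_ge0 ?(ltW p_gt0) // invf_le1 ?exprn_gt0 ?p_gt0 //.
by rewrite exprn_ege1 // ltW // p_gt1.
Qed.

End SumOfUnits.
End Padic.

(** * Spheres, balls and cylinder sets of the tree *)

Section CayleyTreeBalls.
Context {V : choiceType} {e : rel V} {k : nat} (x0 : V).
Hypothesis tree : is_cayley_tree e k.
Local Open Scope classical_set_scope.

Lemma in_sphere n x : (x \in sphere e x0 n) = `[< at_distance e x0 x n >].
Proof.
rewrite /sphere in_fset_set; last exact: finite_sphere tree.
by apply/idP/asboolP; rewrite inE.
Qed.

Lemma exists_distance x : exists n, at_distance e x0 x n.
Proof.
have [s [ps sx]] := tree_connected tree x0 x.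
pose P n := `[< exists s, [/\ path e x0 s, last x0 s = x & size s = n] >].
have exP : exists n, P n by exists (size s); apply/asboolP; exists s.
case: (ex_minnP exP) => n /asboolP Pn min_n; exists n; split=> // t pt tx.
by apply: min_n; apply/asboolP; exists t.
Qed.

Lemma at_distance_pred y n :
  at_distance e x0 y n.+1 -> exists x, at_distance e x0 x n.
Proof.
move=> [[s []]]; case/lastP: s => [//|s z].
rewrite rcons_path last_rcons size_rcons => /andP[ps ez] zy [ss] min_n.
exists (last x0 s); split=> [|t pt tx]; first by exists s.
rewrite -ltnS -(size_rcons t z); apply: min_n; last by rewrite last_rcons.
by rewrite rcons_path pt tx.
Qed.

(** If all distances were below [n], the tree would be a finite union of finite spheres. So some
    vertex is at distance at least [n], and walking back along geodesics reaches distance [n]. *)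
Lemma sphere_neq0 n : sphere e x0 n != fset0.
Proof.
suff [m nm [x xm]] : exists2 m, (n <= m)%N & exists x, at_distance e x0 x m.
  elim: m x nm xm => [|m IH] x.
    rewrite leqn0 => /eqP -> xm.
    by apply/fset0Pn; exists x; rewrite in_sphere; apply/asboolP.
  rewrite leq_eqVlt => /orP[/eqP ->|nm] xm.
    by apply/fset0Pn; exists x; rewrite in_sphere; apply/asboolP.
  by have [y ym] := at_distance_pred xm; exact: IH nm ym.
apply: contrapT => far; apply: (tree_infinite tree).
apply: (@sub_finite_set _ _ (\bigcup_(m in `I_n) [set x | at_distance e x0 x m])).
  move=> x _; have [m xm] := exists_distance x; exists m => //=.
  by rewrite ltnNge; apply/negP => nm; apply: far; exists m => //; exists x.
by apply: bigcup_finite => [|m _]; [exact: finite_II | exact: finite_sphere tree].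
Qed.

Lemma sphere_sub_ball m n : (m <= n)%N ->
  (sphere e x0 m `<=` ball_at e x0 n)%fset.
Proof.
elim: n => [|n IH]; first by rewrite leqn0 => /eqP ->.
rewrite leq_eqVlt ltnS => /orP[/eqP ->|/IH mn]; first exact: fsubsetUr.
exact: fsubset_trans mn (fsubsetUl _ _).
Qed.

Lemma fsubset_ball (A : {fset V}) :
  exists2 n, (1 <= n)%N & (A `<=` ball_at e x0 n)%fset.
Proof.
have [d Hd] := choice exists_distance.
exists (\max_(x <- A) d x).+1 => //; apply/fsubsetP => x xA.
apply: (fsubsetP (sphere_sub_ball (m := d x) _)).
  by apply: leqW; apply: leq_bigmax_seq.
by rewrite in_sphere; apply/asboolP.
Qed.

(** Gibbs measures are prescribed only on balls of positive radius, so cylinders over other finite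
    sets are pulled back to such a ball. *)
Lemma cylinder_ball (T : finType) (X : set (V -> T)) : cylinder X ->
  exists2 n, (1 <= n)%N & exists C : {set {ffun ball_at e x0 n -> T}},
    X = [set sigma | restr (ball_at e x0 n) sigma \in C].
Proof.
move=> [A [C ->]]; have [n n1 An] := fsubset_ball A; exists n => //.
exists [set s : {ffun ball_at e x0 n -> T} | [ffun x : A => s (fincl An x)] \in C]%SET.
apply/seteqP; split=> sigma /=; rewrite finset.in_set;
  by have -> : [ffun x : A => restr (ball_at e x0 n) sigma (fincl An x)]
      = restr A sigma by apply/ffunP => x; rewrite !ffunE.
Qed.

End CayleyTreeBalls.

(** * Gibbs weights, partition functions and boundedness *)

Section GibbsMeasures.
Context {R : realType} {p q k : nat} {K : fieldType} {abs : K -> R}.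
Context {V : choiceType} {e : rel V} {x0 : V} {J : K}.
Hypotheses (p_prime : prime p) (K_Qp : is_Qp p abs).
Hypothesis (tree : is_cayley_tree e k).
Local Open Scope classical_set_scope.
Local Notation Vn := (ball_at e x0).
Local Notation Z := (@partition_function R q K abs V e x0 J).
Local Notation weight := (@gibbs_weight R q K abs V e x0 J).

Lemma abs_finitely_additive_le (mu : set (V -> 'I_q) -> K) (A : {fset V})
    (C : {set {ffun A -> 'I_q}}) (c : R) : 0 <= c -> finitely_additive mu ->
  (forall s, abs (mu [set sigma | restr A sigma = s]) <= c) ->
  abs (mu [set sigma | restr A sigma \in C]) <= c.
Proof.
move=> c0 mu_add mu_le.
have cyl (t : seq {ffun A -> 'I_q}) : cylinder [set sigma | restr A sigma \in t].
  exists A, [set x in t]%SET.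
  by apply/seteqP; split=> sigma /=; rewrite finset.in_set.
(* Induction on a list of configurations: a repeated one leaves the set unchanged, a new one splits
   off a disjoint cylinder. *)
suff H (t : seq {ffun A -> 'I_q}) :
    abs (mu [set sigma | restr A sigma \in t]) <= c.
  have := H (enum C); congr (abs (mu _) <= c).
  by apply/seteqP; split=> sigma /=; rewrite mem_enum.
elim: t => [|s t IH].
  have mu0 : mu set0 = mu set0 + mu set0.
    have cyl0 : cylinder (set0 : set (V -> 'I_q)).
      by have := cyl [::]; congr cylinder; apply/seteqP; split.
    by rewrite -mu_add ?setU0 ?setI0.
  have -> : [set sigma | restr A sigma \in [::]] = set0 :> set (V -> 'I_q).
    by apply/seteqP; split.
  move/eqP: mu0; rewrite -subr_eq0 opprD addrA subrr sub0r oppr_eq0 => /eqP ->.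
  by rewrite (abs0 K_Qp).
have [st|sNt] := boolP (s \in t).
  apply: le_trans IH; rewrite le_eqVlt; apply/orP; left; apply/eqP.
  congr (abs (mu _)); apply/seteqP; split=> sigma /=; rewrite inE.
    by move=> /orP[/eqP ->|].
  by move=> ->; rewrite orbT.
have -> : [set sigma | restr A sigma \in s :: t] =
    [set sigma | restr A sigma = s] `|` [set sigma | restr A sigma \in t].
  apply/seteqP; split=> sigma /=; rewrite inE.
    by move=> /orP[/eqP|]; [left | right].
  by move=> [<-|->]; rewrite ?eqxx ?orbT.
rewrite mu_add //.
- exact: (abs_add_le K_Qp).
- have := cyl [:: s]; congr cylinder.
  by apply/seteqP; split=> sigma /=; rewrite inE => /eqP.
- apply/seteqP; split=> sigma //= [es st].
  by rewrite -es st in sNt.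
Qed.

Section PartitionFunction.
Context {h : V -> 'I_q -> K}.
Hypothesis h_adm : admissible p abs e x0 J h.

Lemma abs_gibbs_weight n (s : {ffun Vn n -> 'I_q}) : (1 <= n)%N ->
  abs (weight h s) = (abs (Z h n))^-1.
Proof.
move=> n1; have [E_small Z0] := h_adm n1.
rewrite (Qp_absM K_Qp) (absV K_Qp) //.
have := abs_padic_exp_sub1_lt p_prime K_Qp (E_small s).
by move=> /(abs_sub1_eq1 p_prime K_Qp) ->; rewrite mulr1.
Qed.

Lemma abs_partition_function_eq1 n : (1 <= n)%N -> ~~ (p %| q)%N ->
  abs (Z h n) = 1.
Proof.
move=> n1 pNq; have [E_small _] := h_adm n1.
apply: (abs_sum_units_eq1 p_prime K_Qp) => [s|].
  exact: abs_padic_exp_sub1_lt.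
by rewrite card_ffun card_ord coprimeXr // prime_coprime.
Qed.

Lemma abs_partition_function_le n : (1 <= n)%N -> (0 < q)%N -> (p %| q)%N ->
  compatible abs e x0 J h ->
  abs (Z h n.+1) <= padic_exp_radius p * abs (Z h n).
Proof.
move=> n1 q0 pq h_comp; have [E_small Zn1] := h_adm (ltn0Sn n).
have [_ Zn] := h_adm n1.
pose s : {ffun Vn n -> 'I_q} := [ffun=> Ordinal q0].
have := congr1 abs (h_comp n n1 s).
rewrite abs_gibbs_weight // -mulr_sumr (Qp_absM K_Qp) (absV K_Qp) //.
(* Solving for the sum [S] of Boltzmann factors over the extensions of [s] gives
   [abs S = abs (Z h n.+1) / abs (Z h n)]. *)
move/(canRL (mulKf _)); rewrite invr_eq0 invrK.
move/(_ (lt0r_neq0 (abs_gt0 K_Qp Zn1))).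
set S := \sum_w _ => eS.
have -> : abs (Z h n.+1) = abs S * abs (Z h n).
  by rewrite eS mulfVK // lt0r_neq0 // (abs_gt0 K_Qp).
apply: ler_wpM2r; first exact: (abs_ge0 K_Qp).
apply: (abs_sum_units_le p_prime K_Qp) => [w|].
  exact: abs_padic_exp_sub1_lt.
(* The number of extensions is a power of [q] with positive exponent, as the sphere is nonempty. *)
rewrite card_ffun card_ord; apply: dvdn_exp => //.
by rewrite -cardfE cardfs_gt0 (sphere_neq0 _ tree).
Qed.

End PartitionFunction.

Lemma gibbs_measure_bounded h (mu : set (V -> 'I_q) -> K) : ~~ (p %| q)%N ->
  gibbs_measure_of p abs e x0 J h mu -> bounded_measure abs mu.
Proof.
move=> pNq [h_adm _ mu_add mu_weight]; exists 1 => _ [X X_cyl <-].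
have [n n1 [C ->]] := cylinder_ball x0 tree X_cyl.
apply: abs_finitely_additive_le => // s.
rewrite mu_weight // (abs_gibbs_weight h_adm) //.
by rewrite (abs_partition_function_eq1 h_adm) // invr1.
Qed.

Lemma gibbs_measure_unbounded h (mu : set (V -> 'I_q) -> K) :
  (0 < q)%N -> (p %| q)%N ->
  gibbs_measure_of p abs e x0 J h mu -> ~ bounded_measure abs mu.
Proof.
move=> q0 pq [h_adm h_comp _ mu_weight] [M mu_le].
have Zgt0 n : 0 < abs (Z h n.+1).
  by apply: (abs_gt0 K_Qp); have [] := h_adm n.+1 isT.
have r0 := @padic_exp_radius_gt0 R p p_prime.
have Zle n : abs (Z h n.+1) <= padic_exp_radius p ^+ n * abs (Z h 1).
  elim: n => [|n IH]; first by rewrite expr0 mul1r.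
  apply: le_trans (abs_partition_function_le h_adm _ q0 pq h_comp) _ => //.
  by rewrite exprS -mulrA ler_wpM2l // ltW.
have Mge n : (abs (Z h n.+1))^-1 <= M.
  pose s : {ffun Vn n.+1 -> 'I_q} := [ffun=> Ordinal q0].
  rewrite -(abs_gibbs_weight h_adm s) // -mu_weight //.
  apply: mu_le; exists [set sigma | restr (Vn n.+1) sigma = s] => //=.
  exists (Vn n.+1), [set s]%SET.
  by apply/seteqP; split=> sigma /=; rewrite finset.in_set1 => /eqP.
(* By [Mge] and [Zle] each term of this null sequence is at least
   [abs (Z h n.+1) ^-1 * abs (Z h n.+1) = 1]. *)
have : (fun n => M * abs (Z h 1) * padic_exp_radius p ^+ n) @ \oo --> (0 : R).
  rewrite -(mulr0 (M * abs (Z h 1))); apply: cvgMr; apply: cvg_expr.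
  by rewrite ger0_norm ?padic_exp_radius_lt1 // ltW.
move=> /cvgrPdist_lt /(_ 1 ltr01) [n _ /(_ n (leqnn n))] /=.
rewrite sub0r normrN => /(le_lt_trans (ler_norm _)); apply/negP; rewrite -leNgt.
rewrite -(mulVf (lt0r_neq0 (Zgt0 n))) -mulrA (mulrC (abs _)).
apply: ler_pM => //; first by rewrite invr_ge0 ltW.
by rewrite ltW.
Qed.

End GibbsMeasures.

Theorem theorem6 (R : realType) (p q : nat) (K : fieldType) (abs : K -> R)
    (V : choiceType) (e : rel V) (x0 : V) (J : K)
    (p_prime : prime p) (K_Qp : is_Qp p abs)
    (tree : is_cayley_tree e 2)
    (q_ge2 : (2 <= q)%N)
    (J_small : abs J < padic_exp_radius p) :
  forall mu : set (V -> 'I_q) -> K,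
    is_TIpGM p abs e x0 J mu ->
    (bounded_measure abs mu <-> ~ (p %| q)%N).
Proof.
move=> mu [h [mu_gibbs _]]; split=> [mu_bounded pq|/negP pNq].
  exact: (gibbs_measure_unbounded p_prime K_Qp tree (ltnW q_ge2) pq mu_gibbs).
exact: (gibbs_measure_bounded p_prime K_Qp tree pNq mu_gibbs).
Qed.
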